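(* Let $k$ be a field, let $E=(E,P,L,d)$ be a fractional Brauer configuration, and let $\Lambda_E=kQ_E/I_E$ be the associated fractional Brauer configuration category. Then the following hold. (1) Let $J$ be the ideal of $\Lambda_E$ generated by the arrows of $Q_E$. Then $J$ is the radical of $\Lambda_E$. (2) $\Lambda_E$ is a locally bounded $k$-category. (3) The Nakayama automorphism $\sigma:E\to E$, $\sigma(e)=g^{d(e)}\cdot e$, induces an automorphism (also denoted $\sigma$) of the category $\Lambda_E$ (sending the object $P(e)$ to $P(\sigma(e))$ and the class of the arrow $L(e)$ to the class of $L(\sigma(e))$).
   Context: Fractional Brauer configuration. Let $G=\langle g\rangle$ be an infinite cyclic group. A fractional Brauer configuration (f-BC) is a quadruple $E=(E,P,L,d)$, where $E$ is a (finite or infinite) $G$-set, $P$ and $L$ are two partitions of $E$ ($P(e)$ and $L(e)$ denote the classes containing $e$), and $d:E\to\mathbb{Z}_{+}$ is a function to the positive integers, such that: (f1) $L(e)\subseteq P(e)$ and $P(e)$ is finite for each $e\in E$; (f2) if $L(e_1)=L(e_2)$ then $P(g\cdot e_1)=P(g\cdot e_2)$; (f3) if $e_1,e_2$ lie in the same $\langle g\rangle$-orbit then $d(e_1)=d(e_2)$; (f4) $P(e_1)=P(e_2)$ if and only if $P(g^{d(e_1)}\cdot e_1)=P(g^{d(e_2)}\cdot e_2)$; (f5) $L(e_1)=L(e_2)$ if and only if $L(g^{d(e_1)}\cdot e_1)=L(g^{d(e_2)}\cdot e_2)$; (f6) for all $e,h\in E$ the formal sequence $L(g^{d(e)-1}\cdot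 e)\cdots L(g\cdot e)L(e)$ is not a proper subsequence (of consecutive terms) of the formal sequence $L(g^{d(h)-1}\cdot h)\cdots L(g\cdot h)L(h)$. Quiver. $Q_E$ has vertex set $\{P(e)\mid e\in E\}$ and arrow set $\{L(e)\mid e\in E\}$, the arrow $L(e)$ going from $P(e)$ to $P(g\cdot e)$. Paths are written from right to left. $kQ_E$ is the path category. Ideal and category. $I_E$ is the ideal of $kQ_E$ generated by: (fR1) $L(g^{d(e)-1-k}\cdot e)\cdots L(g\cdot e)L(e)-L(g^{d(h)-1-k}\cdot h)\cdots L(g\cdot h)L(h)$, where $0\le k\le \min\{d(e),d(h)\}$, $P(e)=P(h)$ and $L(g^{d(e)-i}\cdot e)=L(g^{d(h)-i}\cdot h)$ for $1\le i\le k$; (fR2) paths $L(e_n)\cdots L(e_2)L(e_1)$ with $n>1$ and $\bigcap_{i=1}^n g^{n-i}\cdot L(e_i)=\emptyset$; (fR3) paths $L(g^{n-1}\cdot e)\cdots L(g\cdot e)L(e)$ with $n>d(e)$. (Here the integer $k$ in (fR1) is unrelated to the field.) Then $\Lambda_E=kQ_E/I_E$. Locally bounded category. A $k$-category $\Lambda$ is locally bounded if every endomorphism algebra $\Lambda(x,x)$ is local, distinct objects are non-isomorphic, and for each object $x$, $\sum_{y}\dim_k\Lambda(x,y)<\infty$ and $\sum_y\dim_k\Lambda(y,x)<\infty$. Radical. The radical of a $k$-category $\Lambda$ is the ideal consisting of the morphisms $f:x\to y$ such that $\mathrm{id}_x-f'f$ is invertible for all $f':y\to x$. *)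

(* Defs.v *)
From HB Require Import structures.
From mathcomp Require Import all_boot all_order all_algebra.
From mathcomp Require Import boolp classical_sets functions cardinality.
From mathcomp Require Import finmap monalg.

Set Implicit Arguments.
Unset Strict Implicit.
Unset Printing Implicit Defensive.

Import GRing.Theory.

Local Open Scope fset_scope.
Local Open Scope classical_set_scope.
Local Open Scope ring_scope.
Local Open Scope quotient_scope.

Section QuotientLmodule.
Variables (R : pzRingType) (V : lmodType R).

Record submod := Submod {
  submod_set : set V;
  submod0 : submod_set 0;
  submod_lin : forall a u v,
    submod_set u -> submod_set v -> submod_set (a *: u + v)
}.

Variable U : submod.

Definition submod_pred : {pred V} := fun v => `[< submod_set U v >].

Fact submod_pred_closed : zmod_closed submod_pred.
Proof.
split=> [|u v]; first exact/asboolP/submod0.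
move=> /asboolP Uu /asboolP Uv; apply/asboolP.
by rewrite -scaleN1r addrC; apply: submod_lin.
Qed.

HB.instance Definition _ :=
  GRing.isZmodClosed.Build V submod_pred submod_pred_closed.

Definition quotmod := Quotient.quot submod_pred.
HB.instance Definition _ := GRing.Zmodule.on quotmod.

Definition qpi (v : V) : quotmod := \pi v.

Lemma qpiP u v : qpi u = qpi v <-> submod_set U (u - v).
Proof.
split; first by move=> /eqP; rewrite /qpi -Quotient.idealrBE => /asboolP.
by move=> Uuv; apply/eqP; rewrite /qpi -Quotient.idealrBE; apply/asboolP.
Qed.

Lemma qpi_repr (q : quotmod) : qpi (repr q) = q.
Proof. exact: reprK. Qed.

Fact qpiD u v : qpi (u + v) = qpi u + qpi v.
Proof. exact: Quotient.pi_add. Qed.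

Definition quot_scale (a : R) (q : quotmod) : quotmod := qpi (a *: repr q).

Lemma qpi_scale a v : qpi (a *: v) = quot_scale a (qpi v).
Proof.
apply/qpiP; rewrite -scalerBr -[_ *: _]addr0; apply: submod_lin (submod0 U).
by apply/qpiP; rewrite qpi_repr.
Qed.

Fact quot_scaleA a b u : quot_scale a (quot_scale b u) = quot_scale (a * b) u.
Proof. by rewrite -[u]qpi_repr -!qpi_scale scalerA. Qed.

Fact quot_scale1 : left_id 1 quot_scale.
Proof. by move=> u; rewrite -[u]qpi_repr -qpi_scale scale1r. Qed.

Fact quot_scaleDr : right_distributive quot_scale +%R.
Proof.
move=> a u v; rewrite -[u]qpi_repr -[v]qpi_repr -qpiD -!qpi_scale.
by rewrite scalerDr qpiD.
Qed.

Fact quot_scaleDl u : {morph quot_scale^~ u : a b / a + b}.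
Proof. by move=> a b; rewrite -[u]qpi_repr -!qpi_scale scalerDl qpiD. Qed.

HB.instance Definition _ := GRing.Zmodule_isLmodule.Build R quotmod
  quot_scaleA quot_scale1 quot_scaleDr quot_scaleDl.

Fact qpi_linear : linear qpi.
Proof. by move=> a u v; rewrite qpiD qpi_scale. Qed.

HB.instance Definition _ :=
  GRing.isLinear.Build R V quotmod *:%R qpi qpi_linear.

End QuotientLmodule.

Section FreeModule.
Variables (R : nzRingType) (K : choiceType) (V : lmodType R) (h : K -> V).

Definition flift (f : {malg R[K]}) : V := \sum_(t <- msupp f) f@_t *: h t.

Lemma flift_sub (D : {fset K}) (f : {malg R[K]}) :
  (msupp f `<=` D)%fset -> flift f = \sum_(t <- D) f@_t *: h t.
Proof.
move=> sfD; rewrite /flift (big_fset_incl _ sfD) // => t _ tf.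
by rewrite mcoeff_outdom ?scale0r.
Qed.

Lemma flift_linear : linear flift.
Proof.
move=> a f g; pose D := (msupp f `|` msupp g `|` msupp (a *: f + g))%fset.
have sf : (msupp f `<=` D)%fset by rewrite /D -fsetUA fsubsetUl.
have sg : (msupp g `<=` D)%fset by rewrite /D fsetUAC fsubsetUr.
have sh : (msupp (a *: f + g) `<=` D)%fset by rewrite /D fsubsetUr.
rewrite (flift_sub sf) (flift_sub sg) (flift_sub sh) scaler_sumr -big_split /=.
by apply: eq_bigr => t _; rewrite mcoeffD mcoeffZ scalerDl scalerA.
Qed.

HB.instance Definition _ :=
  GRing.isLinear.Build R {malg R[K]} V *:%R flift flift_linear.

Lemma fliftU t : flift << t >> = h t.
Proof.
have s : (msupp (<< t >> : {malg R[K]}) `<=` [fset t])%fset.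
  by rewrite msuppU oner_eq0.
by rewrite (flift_sub s) big_seq_fset1 mcoeffUU scale1r.
Qed.

End FreeModule.

Lemma malg_linear_ext (R : nzRingType) (K : choiceType) (V : lmodType R)
    (f g : {malg R[K]} -> V) : linear f -> linear g ->
  (forall t, f << t >> = g << t >>) -> f =1 g.
Proof.
move=> lf lg fg u.
pose F : {linear {malg R[K]} -> V} := HB.pack f (GRing.isLinear.Build _ _ _ _ f lf).
pose G : {linear {malg R[K]} -> V} := HB.pack g (GRing.isLinear.Build _ _ _ _ g lg).
rewrite -[f]/(F : _ -> _) -[g]/(G : _ -> _) (monalgE u) !raddf_sum.
apply: eq_bigr => t _; rewrite -[u@_t]mulr1.
have -> : << (u@_t * 1) *g t >> = u@_t *: << t >> :> {malg R[K]}.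
  by apply/malgP => s; rewrite mcoeffZ !mcoeffU mulrnAr.
have FZ a u0 : f (a *: u0) = a *: f u0 by exact: (linearZ_LR F).
have GZ a u0 : g (a *: u0) = a *: g u0 by exact: (linearZ_LR G).
by rewrite /= FZ GZ fg.
Qed.

Record kcat (k : fieldType) := KCat {
  obj :> Type;
  hom : obj -> obj -> lmodType k;
  kid : forall x, hom x x;
  kcomp : forall x y z, hom y z -> hom x y -> hom x z;
  kcompA : forall x y z w (h : hom z w) (g : hom y z) (f : hom x y),
    kcomp h (kcomp g f) = kcomp (kcomp h g) f;
  kcomp1f : forall x y (f : hom x y), kcomp (kid y) f = f;
  kcompf1 : forall x y (f : hom x y), kcomp f (kid x) = f;
  kcomp_linl : forall x y z (f : hom x y), linear (fun g : hom y z => kcomp g f);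
  kcomp_linr : forall x y z (g : hom y z), linear (fun f : hom x y => kcomp g f)
}.
Arguments hom {k} c x y : rename.
Arguments kid {k c} x : rename.
Arguments kcomp {k c x y z} g f : rename.

Section KCatNotions.
Variables (k : fieldType) (C : kcat k).

Definition is_inverse (x y : C) (f : hom C x y) (g : hom C y x) : Prop :=
  kcomp g f = kid x /\ kcomp f g = kid y.

Definition invertible (x y : C) (f : hom C x y) : Prop :=
  exists g, is_inverse f g.

Definition isomorphic (x y : C) : Prop := exists f : hom C x y, invertible f.

Record is_ideal (I : forall x y : C, set (hom C x y)) : Prop := IsIdeal {
  ideal0 : forall x y, I x y 0;
  ideal_lin : forall x y a f g, I x y f -> I x y g -> I x y (a *: f + g);
  ideal_compl : forall x y z (g : hom C y z) f, I x y f -> I x z (kcomp g f);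
  ideal_compr : forall x y z g (f : hom C x y), I y z g -> I x z (kcomp g f)
}.

Definition gen_ideal (S : forall x y : C, set (hom C x y)) (x y : C) :
    set (hom C x y) :=
  [set f | forall I, is_ideal I ->
    (forall u v, S u v `<=` I u v) -> I x y f].

Lemma gen_ideal_is_ideal S : is_ideal (gen_ideal S).
Proof.
split=> [x y|x y a f g Sf Sg|x y z g f Sf|x y z g f Sg] I idI sSI.
- exact: ideal0.
- by apply: ideal_lin => //; [apply: Sf | apply: Sg].
- by apply: ideal_compl => //; apply: Sf.
- by apply: ideal_compr => //; apply: Sg.
Qed.

Definition radical (x y : C) : set (hom C x y) :=
  [set f | forall f' : hom C y x, invertible (kid x - kcomp f' f)].

(* The endomorphism algebra of x is [hom C x x] with product [kcomp]; it is
   local when it has exactly one maximal left ideal. *)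
Definition left_ideal (x : C) (I : set (hom C x x)) : Prop :=
  [/\ I 0, forall f g, I f -> I g -> I (f + g)
    & forall f g, I g -> I (kcomp f g)].

Definition maximal_left_ideal (x : C) (I : set (hom C x x)) : Prop :=
  [/\ left_ideal I, I <> setT
    & forall K, left_ideal K -> I `<=` K -> K = I \/ K = setT].

Definition local_end (x : C) : Prop :=
  exists! I : set (hom C x x), maximal_left_ideal I.

Definition has_dim (V : lmodType k) (n : nat) : Prop :=
  inhabited (Vector.axiom n V).

(* The sum over i of dim (V i) is finite: every dimension is finite and the
   finite partial sums are bounded. *)
Definition finite_total_dim (J : Type) (V : J -> lmodType k) : Prop :=
  exists2 n : J -> nat, (forall i, has_dim (V i) (n i)) &
  exists N : nat, forall m (i : 'I_m -> J), injective i ->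
    (\sum_(j < m) n (i j) <= N)%N.

Definition locally_bounded : Prop :=
  [/\ forall x : C, local_end x,
      forall x y : C, x <> y -> ~ isomorphic x y
    & forall x : C, finite_total_dim (fun y : C => hom C x y) /\
                    finite_total_dim (fun y : C => hom C y x)].

End KCatNotions.
Arguments gen_ideal {k C} S x y : rename.
Arguments radical {k} C x y : rename.
Arguments locally_bounded {k} C : rename.

Record kfunctor (k : fieldType) (C D : kcat k) := KFunctor {
  fobj :> C -> D;
  fmap : forall x y, hom C x y -> hom D (fobj x) (fobj y);
  fmap_lin : forall x y, linear (@fmap x y);
  fmap_id : forall x, fmap (kid x) = kid (fobj x);
  fmap_comp : forall x y z (g : hom C y z) (f : hom C x y),
    fmap (kcomp g f) = kcomp (fmap g) (fmap f)
}.
Arguments fmap {k C D} F {x y} f : rename.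

Section Functors.
Variable k : fieldType.

Definition idfunctor (C : kcat k) : kfunctor C C :=
  @KFunctor k C C id (fun x y f => f)
    (fun _ _ _ _ _ => erefl) (fun _ => erefl) (fun _ _ _ _ _ => erefl).

Section Composition.
Variables (C D B : kcat k) (G : kfunctor D B) (F : kfunctor C D).

Fact compfunctor_lin x y : linear (fun f : hom C x y => fmap G (fmap F f)).
Proof. by move=> a f g; rewrite !fmap_lin. Qed.

Fact compfunctor_id x : fmap G (fmap F (kid x)) = kid (G (F x)).
Proof. by rewrite !fmap_id. Qed.

Fact compfunctor_comp x y z (g : hom C y z) (f : hom C x y) :
  fmap G (fmap F (kcomp g f)) = kcomp (fmap G (fmap F g)) (fmap G (fmap F f)).
Proof. by rewrite !fmap_comp. Qed.

Definition compfunctor : kfunctor C B :=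
  KFunctor compfunctor_lin compfunctor_id compfunctor_comp.

End Composition.

Definition is_automorphism (C : kcat k) (F : kfunctor C C) : Prop :=
  exists G : kfunctor C C,
    compfunctor G F = idfunctor C /\ compfunctor F G = idfunctor C.

End Functors.

Section QuotientCategory.
Variables (k : fieldType) (C : kcat k).
Variables (I : forall x y : C, set (hom C x y)) (idI : is_ideal I).

Definition ideal_submod (x y : C) : submod (hom C x y) :=
  Submod (ideal0 idI x y) (@ideal_lin _ _ _ idI x y).

Definition quot_hom (x y : C) : lmodType k := quotmod (ideal_submod x y).

Definition quot_cls (x y : C) (f : hom C x y) : quot_hom x y :=
  qpi (ideal_submod x y) f.

Definition quot_comp (x y z : C) (g : quot_hom y z) (f : quot_hom x y) :
    quot_hom x z :=
  quot_cls (kcomp (repr g) (repr f)).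

Lemma quot_cls_surj x y (q : quot_hom x y) : exists f, quot_cls f = q.
Proof. by exists (repr q); apply: qpi_repr. Qed.

Lemma quot_cls_linear x y : linear (@quot_cls x y).
Proof. exact: qpi_linear. Qed.

Lemma quot_cls_eq x y (f g : hom C x y) :
  quot_cls f = quot_cls g <-> I (f - g).
Proof. exact: qpiP. Qed.

Lemma quot_compE x y z (g : hom C y z) (f : hom C x y) :
  quot_comp (quot_cls g) (quot_cls f) = quot_cls (kcomp g f).
Proof.
have addI u v (a b : hom C u v) : I a -> I b -> I (a + b).
  by move=> Ia Ib; rewrite -[a]scale1r; apply: ideal_lin.
have subl u v w (b c : hom C v w) (a : hom C u v) :
    kcomp b a - kcomp c a = kcomp (b - c) a.
  have -> : b - c = -1 *: c + b by rewrite scaleN1r addrC.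
  by rewrite kcomp_linl scaleN1r addrC.
have subr u v w (b : hom C v w) (a c : hom C u v) :
    kcomp b a - kcomp b c = kcomp b (a - c).
  have -> : a - c = -1 *: c + a by rewrite scaleN1r addrC.
  by rewrite kcomp_linr scaleN1r addrC.
apply/quot_cls_eq; set g' := repr _; set f' := repr _.
have Ig : I (g' - g) by apply/quot_cls_eq; apply: qpi_repr.
have If : I (f' - f) by apply/quot_cls_eq; apply: qpi_repr.
rewrite -[kcomp g' f'](subrK (kcomp g f')) -addrA subl subr.
by apply: addI; [apply: ideal_compr | apply: ideal_compl].
Qed.

Fact quot_compA x y z w (h : quot_hom z w) (g : quot_hom y z)
    (f : quot_hom x y) :
  quot_comp h (quot_comp g f) = quot_comp (quot_comp h g) f.
Proof.
case: (quot_cls_surj f) (quot_cls_surj g) (quot_cls_surj h) => ? <- [? <-] [? <-].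
by rewrite !quot_compE kcompA.
Qed.

Fact quot_comp1f x y (f : quot_hom x y) : quot_comp (quot_cls (kid y)) f = f.
Proof. by case: (quot_cls_surj f) => ? <-; rewrite quot_compE kcomp1f. Qed.

Fact quot_compf1 x y (f : quot_hom x y) : quot_comp f (quot_cls (kid x)) = f.
Proof. by case: (quot_cls_surj f) => ? <-; rewrite quot_compE kcompf1. Qed.

Fact quot_comp_linl x y z (f : quot_hom x y) :
  linear (fun g : quot_hom y z => quot_comp g f).
Proof.
move=> a g h.
case: (quot_cls_surj f) (quot_cls_surj g) (quot_cls_surj h) => ? <- [? <-] [? <-].
by rewrite -quot_cls_linear !quot_compE kcomp_linl quot_cls_linear.
Qed.

Fact quot_comp_linr x y z (g : quot_hom y z) :
  linear (fun f : quot_hom x y => quot_comp g f).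
Proof.
move=> a f h.
case: (quot_cls_surj f) (quot_cls_surj g) (quot_cls_surj h) => ? <- [? <-] [? <-].
by rewrite -quot_cls_linear !quot_compE kcomp_linr quot_cls_linear.
Qed.

Definition quot_cat : kcat k :=
  KCat quot_compA quot_comp1f quot_compf1 quot_comp_linl quot_comp_linr.

End QuotientCategory.

Record quiver := Quiver {
  vert : choiceType;
  arrow : choiceType;
  src : arrow -> vert;
  tgt : arrow -> vert
}.

(* Paths are written from right to left: the path a_n ... a_1 is the sequence
   [:: a_n; ...; a_1], and composition is concatenation. *)
Fixpoint walk (Q : quiver) (x : vert Q) (s : seq (arrow Q)) (y : vert Q) :=
  if s is a :: s' then (tgt a == y) && walk x s' (src a) else x == y.

Definition qpath (Q : quiver) (x y : vert Q) : choiceType :=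
  {s : seq (arrow Q) | walk x s y}.

Section PathCategory.
Variables (k : fieldType) (Q : quiver).
Implicit Types x y z w : vert Q.

Lemma walk_cat x y z s t : walk x s y -> walk y t z -> walk x (t ++ s) z.
Proof.
move=> xsy; elim: t z => [z /= /eqP <- //|a t IHt z /= /andP[-> yta]].
exact: IHt.
Qed.

Definition pnil x : qpath x x := exist _ [::] (eqxx x).

Definition pcat x y z (q : qpath y z) (p : qpath x y) : qpath x z :=
  exist _ (val q ++ val p) (walk_cat (valP p) (valP q)).

Definition path_hom x y : lmodType k := {malg k[qpath x y]}.

Definition path_comp x y z (g : path_hom y z) (f : path_hom x y) :
    path_hom x z :=
  flift (fun q => flift (fun p => << pcat q p >> : path_hom x z) f) g.

Lemma path_compU x y z (q : qpath y z) (p : qpath x y) :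
  path_comp << q >> << p >> = << pcat q p >>.
Proof. by rewrite /path_comp !fliftU. Qed.

Fact path_comp_linl x y z (f : path_hom x y) :
  linear (fun g : path_hom y z => path_comp g f).
Proof. exact: flift_linear. Qed.

Fact path_comp_linr x y z (g : path_hom y z) :
  linear (fun f : path_hom x y => path_comp g f).
Proof.
move=> a f h; rewrite /path_comp /flift scaler_sumr -big_split /=.
apply: eq_bigr => q _; rewrite -!/(flift _ _) flift_linear scalerDr.
by rewrite !scalerA [a * _]mulrC.
Qed.

Fact path_compA x y z w (h : path_hom z w) (g : path_hom y z)
    (f : path_hom x y) :
  path_comp h (path_comp g f) = path_comp (path_comp h g) f.
Proof.
have Lr := path_comp_linr; have Ll := path_comp_linl.
move: h; apply: malg_linear_ext => [a u v|a u v|r].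
- by rewrite Ll.
- by rewrite !Ll.
move: g; apply: malg_linear_ext => [a u v|a u v|q].
- by rewrite Ll Lr.
- by rewrite Lr Ll.
move: f; apply: malg_linear_ext => [a u v|a u v|p].
- by rewrite !Lr.
- by rewrite Lr.
by rewrite !path_compU; congr << _ >>; apply: val_inj; rewrite /= catA.
Qed.

Fact path_comp1f x y (f : path_hom x y) : path_comp << pnil y >> f = f.
Proof.
move: f; apply: malg_linear_ext => [||p]; [exact: path_comp_linr | by [] |].
by rewrite path_compU; congr << _ >>; apply: val_inj.
Qed.

Fact path_compf1 x y (f : path_hom x y) : path_comp f << pnil x >> = f.
Proof.
move: f; apply: malg_linear_ext => [||p]; [exact: path_comp_linl | by [] |].
by rewrite path_compU; congr << _ >>; apply: val_inj; rewrite /= cats0.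
Qed.

Definition path_cat : kcat k :=
  KCat path_compA path_comp1f path_compf1 path_comp_linl path_comp_linr.

Definition path_mor x y (p : qpath x y) : hom path_cat x y := << p >>.

End PathCategory.

(* The classes of a partition of T are given by the map sending a point to the
   class containing it. *)
Definition is_partition (T : Type) (P : T -> set T) : Prop :=
  (forall e, P e e) /\ (forall e h, P e h -> P h = P e).

(* The infinite cyclic group <g> is written additively as [int], with g = 1:
   [act n e] is g^n . e. *)
Record fbc := FBC {
  pt :> Type;
  act : int -> pt -> pt;
  act0 : forall e, act 0 e = e;
  actD : forall m n e, act (m + n) e = act m (act n e);
  Pcl : pt -> set pt;
  Lcl : pt -> set pt;
  deg : pt -> nat;
  Pcl_partition : is_partition Pcl;
  Lcl_partition : is_partition Lcl;
  deg_gt0 : forall e, (0 < deg e)%N;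
  f1 : forall e, Lcl e `<=` Pcl e /\ finite_set (Pcl e);
  f2 : forall e1 e2, Lcl e1 = Lcl e2 -> Pcl (act 1 e1) = Pcl (act 1 e2);
  f3 : forall e1 e2, (exists n, e2 = act n e1) -> deg e1 = deg e2;
  f4 : forall e1 e2, Pcl e1 = Pcl e2 <->
    Pcl (act (deg e1)%:Z e1) = Pcl (act (deg e2)%:Z e2);
  f5 : forall e1 e2, Lcl e1 = Lcl e2 <->
    Lcl (act (deg e1)%:Z e1) = Lcl (act (deg e2)%:Z e2);
  f6 : let Lseq e := [seq Lcl (act i%:Z e) | i <- rev (iota 0 (deg e))] in
    forall e h, ~~ (infix (Lseq e) (Lseq h) && (Lseq e != Lseq h))
}.

Section Configuration.
Variable E : fbc.
Implicit Types e h : E.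

Definition vtx e : range (@Pcl E) :=
  exist _ (Pcl e) (mem_set (imageT (@Pcl E) e)).

Definition arr e : range (@Lcl E) :=
  exist _ (Lcl e) (mem_set (imageT (@Lcl E) e)).

Definition arr_rep (a : range (@Lcl E)) : E :=
  projT1 (cid2 (set_mem (valP a))).

(* Source and target do not depend on the representative: see [src_arr] and
   [tgt_arr]. *)
Definition fbc_quiver : quiver :=
  @Quiver (range (@Pcl E)) (range (@Lcl E))
    (fun a => vtx (arr_rep a)) (fun a => vtx (act 1 (arr_rep a))).

Lemma arr_repE e : Lcl (arr_rep (arr e)) = Lcl e.
Proof. by rewrite /arr_rep; case: cid2. Qed.

Lemma src_arr e : @src fbc_quiver (arr e) = vtx e.
Proof.
apply: val_inj => /=; apply: (Pcl_partition E).2.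
apply: (f1 e).1; rewrite -arr_repE; exact: (Lcl_partition E).1.
Qed.

Lemma tgt_arr e : @tgt fbc_quiver (arr e) = vtx (act 1 e).
Proof. by apply: val_inj => /=; apply/f2/arr_repE. Qed.

(* L(g^(n-1).e) ... L(g.e) L(e) *)
Definition orbit_seq (n : nat) e : seq (arrow fbc_quiver) :=
  [seq arr (act i%:Z e) | i <- rev (iota 0 n)].

Lemma orbit_seq_walk n e :
  @walk fbc_quiver (vtx e) (orbit_seq n e) (vtx (act n%:Z e)).
Proof.
elim: n => [|n IHn]; first by rewrite /= act0.
have -> : orbit_seq n.+1 e = arr (act n%:Z e) :: orbit_seq n e.
  by rewrite /orbit_seq -addn1 iotaD rev_cat map_cat add0n.
change ((@tgt fbc_quiver (arr (act n%:Z e)) == vtx (act n.+1%:Z e)) &&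
  @walk fbc_quiver (vtx e) (orbit_seq n e) (@src fbc_quiver (arr (act n%:Z e)))).
by rewrite tgt_arr src_arr IHn andbT -actD intS.
Qed.

Variable k : fieldType.

(* The two paths are parallel, by f2 and f4, so requiring them to have common
   endpoints excludes nothing. For j = deg e the first path is trivial. *)
Definition fR1 (x y : path_cat k fbc_quiver) :
    set (hom (path_cat k fbc_quiver) x y) :=
  [set f | exists (e h : E) (j : nat) (p q : qpath x y),
    [/\ (j <= minn (deg e) (deg h))%N, Pcl e = Pcl h,
        forall i, (1 <= i <= j)%N ->
          Lcl (act (deg e - i)%N%:Z e) = Lcl (act (deg h - i)%N%:Z h),
        x = vtx e /\
        val p = orbit_seq (deg e - j) e /\ val q = orbit_seq (deg h - j) h
      & f = path_mor k p - path_mor k q]].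

(* A path L(e_n) ... L(e_1) is presented by any choice of representatives. *)
Definition fR2 (x y : path_cat k fbc_quiver) :
    set (hom (path_cat k fbc_quiver) x y) :=
  [set f | exists (n : nat) (e : nat -> E) (p : qpath x y),
    [/\ (1 < n)%N, val p = [seq arr (e i) | i <- rev (iota 1 n)],
        \bigcap_(i in [set i | (1 <= i <= n)%N])
          (act (n - i)%N%:Z @` Lcl (e i)) = set0
      & f = path_mor k p]].

Definition fR3 (x y : path_cat k fbc_quiver) :
    set (hom (path_cat k fbc_quiver) x y) :=
  [set f | exists (n : nat) (e : E) (p : qpath x y),
    [/\ (deg e < n)%N, val p = orbit_seq n e & f = path_mor k p]].

Arguments fR1 x y : clear implicits.
Arguments fR2 x y : clear implicits.
Arguments fR3 x y : clear implicits.

Definition fbc_relations (x y : path_cat k fbc_quiver) :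
    set (hom (path_cat k fbc_quiver) x y) :=
  fR1 x y `|` fR2 x y `|` fR3 x y.

Definition fbc_cat : kcat k := quot_cat (gen_ideal_is_ideal fbc_relations).

Definition path_class (x y : fbc_cat) (p : @qpath fbc_quiver x y) :
    hom fbc_cat x y :=
  quot_cls (gen_ideal_is_ideal fbc_relations) (path_mor k p).

Definition arrow_classes (x y : fbc_cat) : set (hom fbc_cat x y) :=
  [set f | exists (e : E) (p : @qpath fbc_quiver x y),
    val p = [:: arr e] /\ f = path_class p].

Definition nakayama e : E := act (deg e)%:Z e.

End Configuration.
Arguments fbc_cat E k : clear implicits.
Arguments arrow_classes E k x y : clear implicits.

(* Main.v *)
From mathcomp Require Import all_boot all_order all_algebra.
From mathcomp Require Import boolp classical_sets functions cardinality.
From mathcomp Require Import monalg.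
Require Import Defs.

(** Everything follows from the description of the nonzero paths. If a path
    L(e_n) ... L(e_1) with n > 1 is nonzero in the category, then (fR2) is not
    applicable, so some point z lies in all the translates g^(n-i).L(e_i); with
    e = g^(1-n).z the path is L(g^(n-1).e) ... L(g.e) L(e), a piece of a single
    orbit, and (fR3) forces n <= d(e) ([path_orbit]). A nonzero path is thus
    determined by its first (or its last) point and its length. As classes of P
    are finite and d is constant on orbits, only finitely many nonzero paths
    start (or end) at a given vertex; this bounds the total dimensions
    ([outgoing_dim], [incoming_dim]) and shows that a morphism f : x -> x in the
    ideal J generated by the arrows is nilpotent, so that 1 - f is invertible
    ([deep_unit]).

    Conversely J is proper. By (f6) a relation (fR1) whose left path is trivial
    also has a trivial right path, so every relation has zero augmentation, the
    augmentation being the coefficient of the trivial path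
    ([relations_augmentation]). The augmentation is multiplicative and vanishes
    on arrows; hence it kills J but not identities ([arrow_ideal_id]). Every
    endomorphism of x is a scalar modulo J, and every morphism between distinct
    vertices lies in J. An ideal with these properties is the radical, the
    endomorphism algebras are local with maximal ideal J, and isomorphic
    objects are equal ([ideal_radical], [local_end_ideal], [isomorphic_eq]).

    Finally, (f3), (f4) and (f5) say that the Nakayama permutation commutes with
    g and preserves d and both partitions in both directions. Any permutation
    with these properties, as well as its inverse, respects the relations and
    therefore acts on the category; the two induced functors are mutually
    inverse since they are so on paths ([sym_functorK]). *)

Set Implicit Arguments.
Unset Strict Implicit.
Unset Printing Implicit Defensive.
Import GRing.Theory.
Local Open Scope classical_set_scope.
Local Open Scope ring_scope.

(** * Linear spans and dimension *)

Section Spanning.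
Variables (k : fieldType) (V : lmodType k).

(** Defined through all the submodules containing S, so that a property of the
    elements of a span is proved by presenting the property as a submodule. *)
Definition spans (S : set V) (v : V) : Prop :=
  forall U : submod V, S `<=` submod_set U -> submod_set U v.

Definition span_submod (S : set V) : submod V.
Proof.
exists (spans S) => [U _|a u v Su Sv U SU]; first exact: submod0.
by apply: submod_lin; [apply: Su | apply: Sv].
Defined.

Definition zero_submod : submod V.
Proof. by exists [set 0] => // a u v -> ->; rewrite /= scaler0 addr0. Defined.

Lemma submodZ (U : submod V) a v : submod_set U v -> submod_set U (a *: v).
Proof. by move=> Uv; rewrite -[_ *: _]addr0; apply: submod_lin (submod0 U). Qed.

Lemma submodD (U : submod V) u v :
  submod_set U u -> submod_set U v -> submod_set U (u + v).
Proof. by move=> Uu; rewrite -[u]scale1r; apply: submod_lin. Qed.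

Lemma submod_sum (U : submod V) (I : Type) (r : seq I) (P : pred I)
    (F : I -> V) :
  (forall i, P i -> submod_set U (F i)) ->
  submod_set U (\sum_(i <- r | P i) F i).
Proof.
by move=> UF; elim/big_ind: _ => //; [apply: submod0 | apply: submodD].
Qed.

Lemma spans_incl (S : set V) v : S v -> spans S v.
Proof. by move=> Sv U SU; apply: SU. Qed.

Definition spanning m (b : 'I_m -> V) := forall v, spans (range b) v.

(** Vectors are dropped from the family one at a time: a nonzero kernel vector of
    the map from row vectors makes one of them a combination of the others, and
    once the kernel is zero that map is an isomorphism. *)
Lemma spanning_dim m (b : 'I_m -> V) : spanning b ->
  exists2 n, (n <= m)%N & has_dim V n.
Proof.
elim: m b => [|m IHm] b bV.
- exists 0%N => //; constructor; exists (fun=> 0) => [a u v|].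
    by rewrite scaler0 addr0.
  exists (fun=> 0) => [v|r]; last by apply/rowP; case.
  by apply/esym/(bV v zero_submod) => y [[]].
pose phi (r : 'rV[k]_m.+1) := \sum_i r 0 i *: b i.
have phiL : linear phi.
  move=> a r s; rewrite /phi scaler_sumr -big_split /=; apply: eq_bigr => i _.
  by rewrite !mxE scalerDl scalerA.
have phi_surj v : exists r, phi r = v.
  have im0 : range phi 0.
    by exists 0 => //; rewrite /phi big1 // => i _; rewrite mxE scale0r.
  have imL a u w : range phi u -> range phi w -> range phi (a *: u + w).
    by move=> [r _ <-] [s _ <-]; exists (a *: r + s) => //; rewrite phiL.
  have [|r _ <-] := bV v (Submod im0 imL); last by exists r.
  move=> _ [i _ <-]; exists (delta_mx 0 i) => //.
  rewrite /phi (bigD1 i) //= mxE !eqxx scale1r big1 ?addr0 // => j /negPf ji.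
  by rewrite mxE ji andbF scale0r.
have [[r phir [i ri]]|noker] :=
  pselect (exists2 r, phi r = 0 & exists i, r 0 i != 0).
  have [|n nm Vn] := IHm (fun j => b (lift i j)); last first.
    by exists n => //; apply: leqW.
  move=> v U bU; apply: bV => _ [j _ <-].
  have [->|] := eqVneq j i; last first.
    by case: (unliftP i j) => [j' ->|-> /eqP//] _; apply: bU; exists j'.
  have -> : b i = - (r 0 i)^-1 *: \sum_(j < m.+1 | j != i) r 0 j *: b j.
    move: phir; rewrite /phi (bigD1 i) //= => /eqP; rewrite addrC addr_eq0.
    move=> /eqP->; rewrite scalerN scaleNr opprK scalerA mulVf //.
    by rewrite scale1r.
  apply: submodZ; apply: submod_sum => l li; apply: submodZ.
  case: (unliftP i l) li => [l' -> _|->]; last by rewrite eqxx.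
  by apply: bU; exists l'.
exists m.+1 => //; constructor.
pose psi v := projT1 (cid (phi_surj v)).
have psiK : cancel psi phi by move=> v; rewrite /psi; case: cid.
have phi_inj : injective phi.
  move=> r s rs; apply/eqP; rewrite -subr_eq0; apply/eqP/rowP => i; rewrite mxE.
  apply/eqP; apply: contrapT => /negP rsi; apply: noker; exists (r - s).
    by rewrite -[r - s]addrC -scaleN1r phiL rs scaleN1r addNr.
  by exists i; move: rsi; rewrite !mxE.
have phiK : cancel phi psi by move=> r; apply: phi_inj; rewrite psiK.
exists psi; last by exists phi.
by move=> a u v; apply: phi_inj; rewrite phiL !psiK.
Qed.

End Spanning.

Lemma spans_map (k : fieldType) (V W : lmodType k) (f : V -> W) S T v :
  linear f -> (forall u, S u -> spans T (f u)) -> spans S v -> spans T (f v).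
Proof.
move=> lf ST Sv.
have f0 : spans T (f 0).
  rewrite -{1}[0]addr0 -{1}[0](scaler0 _ (-1)) lf scaleN1r addNr.
  exact: (submod0 (span_submod T)).
have fL a u w : spans T (f u) -> spans T (f w) -> spans T (f (a *: u + w)).
  by rewrite lf; apply: (submod_lin (s := span_submod T)).
exact: (Sv (Submod f0 fL)).
Qed.

Lemma fin_spanning_dim (k : fieldType) (V : lmodType k) (I : finType)
    (A : {set I}) (b : I -> V) :
  (forall v, spans (b @` [set` A]) v) -> exists2 n, (n <= #|A|)%N & has_dim V n.
Proof.
move=> bV; apply: (@spanning_dim _ _ _ (fun j : 'I_#|A| => b (enum_val j))).
move=> v U bU; apply: bV => _ [i /= Ai <-].
by apply: bU; exists (enum_rank_in Ai i) => //; rewrite enum_rankK_in.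
Qed.

(** Each vector of a finite family is charged to a single index [t i], so the
    dimensions of the spanned modules add up to at most the size of the family.
    Indexing [b] by i and j, instead of giving a vector of [V (t i)], avoids
    transporting vectors along equalities of indices. *)
Lemma finite_total_dim_spanning (k : fieldType) (J : Type)
    (V : J -> lmodType k) (I : finType) (t : I -> J) (b : forall i j, V j) :
  (forall j v, spans [set b i j | i in [set i | t i = j]] v) ->
  finite_total_dim V.
Proof.
move=> bV; pose A j := [set i | `[< t i = j >]]%SET.
have dimV j : exists n, (n <= #|A j|)%N /\ has_dim (V j) n.
  have [|n] := @fin_spanning_dim _ (V j) I (A j) (b ^~ j); last by exists n.
  move=> v U bU; apply: bV => _ [i /= ti <-]; apply: bU; exists i => //=.
  by rewrite inE; apply/asboolP.
exists (fun j => projT1 (cid (dimV j))) => [j|]; first by case: cid => n [].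
exists #|I| => m i i_inj.
apply: (@leq_trans (\sum_(j < m) #|A (i j)|)%N).
  by apply: leq_sum => j _; case: cid => n [].
rewrite (eq_bigr (fun j => \sum_(l : I) (l \in A (i j)))%N); last first.
  by move=> j _; rewrite -sum1_card [LHS]big_mkcond.
rewrite exchange_big -sum1_card /=; apply: leq_sum => l _.
have [[j tj]|none] := pselect (exists j, t l = i j); last first.
  rewrite big1 // => j _; rewrite inE; case: asboolP => // tl.
  by case: none; exists j.
rewrite (bigD1 j) //= big1 ?addn0 ?leq_b1 // => j' /eqP j'j.
by rewrite inE; case: asboolP => //; rewrite tj => /i_inj /esym.
Qed.

(** * Composition, ideals and the radical *)

Section Composition.
Variables (k : fieldType) (C : kcat k).
Implicit Types x y z : C.

Lemma kcomp0f x y z (f : hom C x y) : kcomp (0 : hom C y z) f = 0.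
Proof.
by rewrite -{1}[0]addr0 -{1}[0](scaler0 _ (-1)) kcomp_linl scaleN1r addNr.
Qed.

Lemma kcompf0 x y z (g : hom C y z) : kcomp g (0 : hom C x y) = 0.
Proof.
by rewrite -{1}[0]addr0 -{1}[0](scaler0 _ (-1)) kcomp_linr scaleN1r addNr.
Qed.

Lemma kcompDl x y z (g h : hom C y z) (f : hom C x y) :
  kcomp (g + h) f = kcomp g f + kcomp h f.
Proof. by rewrite -[g]scale1r kcomp_linl !scale1r. Qed.

Lemma kcompDr x y z (g : hom C y z) (f h : hom C x y) :
  kcomp g (f + h) = kcomp g f + kcomp g h.
Proof. by rewrite -[f]scale1r kcomp_linr !scale1r. Qed.

Lemma kcompZl x y z a (g : hom C y z) (f : hom C x y) :
  kcomp (a *: g) f = a *: kcomp g f.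
Proof. by rewrite -[_ *: g]addr0 kcomp_linl kcomp0f addr0. Qed.

Lemma kcompZr x y z a (g : hom C y z) (f : hom C x y) :
  kcomp g (a *: f) = a *: kcomp g f.
Proof. by rewrite -[_ *: f]addr0 kcomp_linr kcompf0 addr0. Qed.

Lemma kcompNl x y z (g : hom C y z) (f : hom C x y) :
  kcomp (- g) f = - kcomp g f.
Proof. by rewrite -scaleN1r kcompZl scaleN1r. Qed.

Lemma kcompNr x y z (g : hom C y z) (f : hom C x y) :
  kcomp g (- f) = - kcomp g f.
Proof. by rewrite -scaleN1r kcompZr scaleN1r. Qed.

Lemma invertible_lr x y (f : hom C x y) (g h : hom C y x) :
  kcomp g f = kid x -> kcomp f h = kid y -> invertible f.
Proof.
move=> gf fh; exists g; split=> //.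
by rewrite -[g]kcompf1 -fh (kcompA g) gf kcomp1f.
Qed.

Lemma invertibleZ x y a (f : hom C x y) :
  a != 0 -> invertible f -> invertible (a *: f).
Proof.
move=> a0 [g [gf fg]]; exists (a^-1 *: g).
by split; rewrite kcompZl kcompZr scalerA ?mulVf ?mulfV // scale1r.
Qed.

(** From 1 - f^2 = (1 - f)(1 + f) = (1 + f)(1 - f); repeated squaring then deals
    with nilpotent f. *)
Lemma invertible_sqr x (f : hom C x x) :
  invertible (kid x - kcomp f f) -> invertible (kid x - f).
Proof.
move=> [g [gf fg]].
have E1 : kcomp (kid x + f) (kid x - f) = kid x - kcomp f f.
  by rewrite kcompDl !kcompDr !kcompNr !kcomp1f kcompf1 addrA subrK.
have E2 : kcomp (kid x - f) (kid x + f) = kid x - kcomp f f.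
  by rewrite kcompDl !kcompDr !kcompNl !kcomp1f kcompf1 addrA addrK.
apply: (@invertible_lr _ _ _ (kcomp g (kid x + f)) (kcomp (kid x + f) g)).
  by rewrite -kcompA E1.
by rewrite kcompA E2.
Qed.

Section Ideal.
Variables (I : forall x y : C, set (hom C x y)) (idI : is_ideal I).

Lemma idealD x y (f g : hom C x y) : I f -> I g -> I (f + g).
Proof. by move=> If; rewrite -[f]scale1r; apply: ideal_lin. Qed.

Lemma idealZ x y a (f : hom C x y) : I f -> I (a *: f).
Proof.
by move=> If; rewrite -[_ *: f]addr0; apply: ideal_lin => //; apply: ideal0.
Qed.

Lemma idealN x y (f : hom C x y) : I f -> I (- f).
Proof. by rewrite -scaleN1r; apply: idealZ. Qed.

End Ideal.

Lemma gen_ideal_incl S x y (f : hom C x y) : S x y f -> gen_ideal S x y f.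
Proof. by move=> Sf I _ /(_ x y f Sf). Qed.

End Composition.

(** An ideal that looks like a radical is the radical, and forces the category
    to have local endomorphism algebras and no isomorphism between distinct
    objects. *)
Section RadicalCriterion.
Variables (k : fieldType) (C : kcat k).
Variables (J : forall x y : C, set (hom C x y)) (idJ : is_ideal J).
Hypothesis J_id : forall x, ~ J (kid x).
Hypothesis J_scalar : forall x (f : hom C x x), exists c, J (f - c *: kid x).
Hypothesis J_off : forall x y (f : hom C x y), x <> y -> J f.
Hypothesis J_unit : forall x (f : hom C x x), J f -> invertible (kid x - f).

(** f = c + j with c a nonzero scalar and j in J, and 1 + j/c is invertible. *)
Lemma invertible_notin x (f : hom C x x) : ~ J f -> invertible f.
Proof.
move=> nJf; have [c Jc] := J_scalar f.
have c0 : c != 0.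
  by apply/eqP => c0; apply: nJf; move: Jc; rewrite c0 scale0r subr0.
have -> : f = c *: (kid x - - (c^-1 *: (f - c *: kid x))).
  by rewrite opprK scalerDr scalerA mulfV // scale1r addrC subrK.
by apply: invertibleZ => //; apply: J_unit; apply: idealN => //; apply: idealZ.
Qed.

Lemma notin_invertible x y (f : hom C x y) : invertible f -> ~ J f.
Proof.
move=> [g [gf _]] Jf; apply: (J_id (x := x)); rewrite -gf.
exact: ideal_compl.
Qed.

Lemma ideal_radical x y : @J x y = radical C x y.
Proof.
apply/seteqP; split=> [f Jf f'|f radf].
  by apply: J_unit; apply: ideal_compl.
apply: contrapT => nJf.
have xy : x = y by apply: contrapT => /(J_off f).
(* For the inverse g of f, the morphism 1 - gf = 0 would be invertible. *)
subst y; have [g [gf fg]] := invertible_notin nJf.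
have [h [hf _]] := radf g; apply: (J_id (x := x)).
by rewrite -hf gf subrr kcompf0; apply: ideal0.
Qed.

(** Everything outside J is invertible, so a proper left ideal lies in J. *)
Lemma local_end_ideal x : @local_end k C x.
Proof.
have lJ : left_ideal (@J x x).
  split=> [|f g|f g]; [exact: ideal0 | exact: idealD | exact: ideal_compl].
have proper I : left_ideal I -> I <> setT -> I `<=` @J x x.
  move=> [I0 ID IM] IT f If; apply: contrapT => /invertible_notin [g [gf _]].
  apply: IT; apply/seteqP; split=> // h _; rewrite -[h]kcompf1 -gf.
  exact/IM/IM.
exists (@J x x); split=> [|I [lI IT Imax]].
  split=> // [JT|K lK JK]; first by apply: (J_id (x := x)); rewrite JT.
  have [->|KT] := pselect (K = setT); [by right | left].
  by apply/seteqP; split=> //; apply: proper.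
have [//|/(congr1 (fun S => S (kid x)))] := Imax _ lJ (proper _ lI IT).
by move=> JT; case: (J_id (x := x)); rewrite JT.
Qed.

Lemma isomorphic_eq (x y : C) : isomorphic x y -> x = y.
Proof.
by move=> [f /notin_invertible nJf]; apply: contrapT => /(J_off f).
Qed.

End RadicalCriterion.

(** * Functors between quotients of path categories *)

Lemma image_is_ideal (k : fieldType) (C : kcat k)
    (I K : forall x y : C, set (hom C x y)) (idI : is_ideal I) :
  is_ideal K ->
  is_ideal (fun x y : quot_cat idI => @quot_cls _ _ _ idI x y @` K x y).
Proof.
move=> idK; split=> [x y|x y a _ _ [f Kf <-] [g Kg <-]|x y z g _ [f Kf <-]
                    |x y z _ f [g Kg <-]] /=.
- by exists 0; [apply: ideal0 | rewrite /quot_cls (raddf0 (qpi _))].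
- by exists (a *: f + g); [apply: ideal_lin | apply: quot_cls_linear].
- have [g' <-] := quot_cls_surj g; exists (kcomp g' f).
    exact: ideal_compl.
  by rewrite -quot_compE.
- have [f' <-] := quot_cls_surj f; exists (kcomp g f').
    exact: ideal_compr.
  by rewrite -quot_compE.
Qed.

Section QuotientFunctor.
Variables (k : fieldType) (C D : kcat k) (F : kfunctor C D).

Lemma fmapB x y (f g : hom C x y) : fmap F (f - g) = fmap F f - fmap F g.
Proof. by rewrite -scaleN1r addrC fmap_lin scaleN1r addrC. Qed.

Lemma fmap0 x y : fmap F (0 : hom C x y) = 0.
Proof. by rewrite -{1}(subrr 0) fmapB subrr. Qed.

Lemma preimage_is_ideal (J : forall x y : D, set (hom D x y)) :
  is_ideal J ->
  is_ideal (fun x y : C => [set f : hom C x y | J _ _ (fmap F f)]).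
Proof.
move=> idJ; split=> [x y|x y a f g Jf Jg|x y z g f Jf|x y z g f Jg] /=.
- by rewrite fmap0; apply: ideal0.
- by rewrite fmap_lin; apply: ideal_lin.
- by rewrite fmap_comp; apply: ideal_compl.
- by rewrite fmap_comp; apply: ideal_compr.
Qed.

Variables (I : forall x y : C, set (hom C x y)) (idI : is_ideal I).
Variables (J : forall x y : D, set (hom D x y)) (idJ : is_ideal J).
Hypothesis F_ideal : forall (x y : C) (f : hom C x y), I f -> J (fmap F f).

Definition quot_fmap (x y : quot_cat idI) (q : hom (quot_cat idI) x y) :
    hom (quot_cat idJ) (F x) (F y) := quot_cls idJ (fmap F (repr q)).

Lemma quot_fmapE (x y : C) (f : hom C x y) :
  @quot_fmap x y (quot_cls idI f) = quot_cls idJ (fmap F f).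
Proof.
by apply/quot_cls_eq; rewrite -fmapB; apply/F_ideal/quot_cls_eq/qpi_repr.
Qed.

Fact quot_fmap_lin x y : linear (@quot_fmap x y).
Proof.
move=> a f g; case: (quot_cls_surj f) (quot_cls_surj g) => ? <- [? <-].
by rewrite -quot_cls_linear !quot_fmapE fmap_lin quot_cls_linear.
Qed.

Fact quot_fmap_id x : quot_fmap (kid x) = kid (F x : quot_cat idJ).
Proof. by rewrite [LHS]quot_fmapE fmap_id. Qed.

Fact quot_fmap_comp (x y z : quot_cat idI) (g : hom (quot_cat idI) y z)
    (f : hom (quot_cat idI) x y) :
  quot_fmap (kcomp g f) = kcomp (quot_fmap g) (quot_fmap f).
Proof.
case: (quot_cls_surj f) (quot_cls_surj g) => f' <- [g' <-].
by rewrite /= quot_compE !quot_fmapE quot_compE fmap_comp.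
Qed.

Definition quot_functor : kfunctor (quot_cat idI) (quot_cat idJ) :=
  KFunctor quot_fmap_lin quot_fmap_id quot_fmap_comp.

End QuotientFunctor.

Lemma walk_ends (Q : quiver) (x y x' y' : vert Q) (s : seq (arrow Q)) :
  s != [::] -> walk x s y -> walk x' s y' -> x = x' /\ y = y'.
Proof.
case: s => // a s _ /= /andP[/eqP <- ws] /andP[/eqP <- ws']; split=> //.
elim: s a ws ws' => /= [a /eqP -> /eqP //|b s IHs a].
by move=> /andP[_ ws] /andP[_]; apply: IHs ws.
Qed.

Record quiver_mor (Q Q' : quiver) := QuiverMor {
  on_vert : vert Q -> vert Q';
  on_arrow : arrow Q -> arrow Q';
  on_src : forall a, src (on_arrow a) = on_vert (src a);
  on_tgt : forall a, tgt (on_arrow a) = on_vert (tgt a)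
}.

Section PathFunctor.
Variables (k : fieldType) (Q Q' : quiver) (phi : quiver_mor Q Q').
Implicit Types x y z : vert Q.

Lemma walk_map x (s : seq (arrow Q)) y : walk x s y ->
  walk (on_vert phi x) [seq on_arrow phi a | a <- s] (on_vert phi y).
Proof.
elim: s y => /= [y /eqP ->//|a s IHs y /andP[/eqP <- ws]].
by rewrite on_tgt eqxx on_src IHs.
Qed.

Definition pmap_path x y (p : qpath x y) :
    qpath (on_vert phi x) (on_vert phi y) :=
  exist _ [seq on_arrow phi a | a <- val p] (walk_map (valP p)).

Definition path_fmap (x y : path_cat k Q) (f : hom (path_cat k Q) x y) :
    hom (path_cat k Q') (on_vert phi x) (on_vert phi y) :=
  flift (fun p => path_mor k (pmap_path p)) f.

Fact path_fmap_lin x y : linear (@path_fmap x y).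
Proof. exact: flift_linear. Qed.

Lemma path_fmapE x y (p : qpath x y) :
  path_fmap (path_mor k p) = path_mor k (pmap_path p).
Proof. exact: fliftU. Qed.

Fact path_fmap_id (x : path_cat k Q) :
  path_fmap (kid x) = @kid _ (path_cat k Q') (on_vert phi x).
Proof.
rewrite [LHS]path_fmapE; congr << _ >>; exact: val_inj.
Qed.

Fact path_fmap_comp (x y z : path_cat k Q) (g : hom (path_cat k Q) y z)
    (f : hom (path_cat k Q) x y) :
  path_fmap (kcomp g f) = kcomp (path_fmap g) (path_fmap f).
Proof.
have Lr := @kcomp_linr; have Ll := @kcomp_linl; have L := path_fmap_lin.
move: g; apply: malg_linear_ext => [a u v|a u v|q].
- by rewrite Ll L.
- by rewrite L Ll.
move: f; apply: malg_linear_ext => [a u v|a u v|p].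
- by rewrite Lr L.
- by rewrite L Lr.
rewrite -/(path_mor k q) -/(path_mor k p) !path_fmapE /= !path_compU.
rewrite [LHS]path_fmapE; congr << _ >>.
by apply: val_inj; rewrite /= map_cat.
Qed.

Definition path_functor : kfunctor (path_cat k Q) (path_cat k Q') :=
  @KFunctor k (path_cat k Q) (path_cat k Q') (on_vert phi) path_fmap
    path_fmap_lin path_fmap_id path_fmap_comp.

End PathFunctor.

(** * Nonzero paths *)

Section Paths.
Variables (E : fbc) (k : fieldType).
Local Notation Q := (fbc_quiver E).
Local Notation C := (fbc_cat E k).
Local Notation cls := (@path_class E k _ _).
Implicit Types (e h z : E) (x y : vert Q) (a : arrow Q).

Lemma actK n : cancel (act n) (@act E (- n)).
Proof. by move=> e; rewrite -actD addNr act0. Qed.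

Lemma actKV n : cancel (act (- n)) (@act E n).
Proof. by move=> e; rewrite -actD addrN act0. Qed.

Lemma Lcl_eq e h : Lcl e h -> Lcl h = Lcl e.
Proof. exact: (Lcl_partition E).2. Qed.

Lemma Lcl_refl e : Lcl e e. Proof. exact: (Lcl_partition E).1. Qed.

Lemma Pcl_refl e : Pcl e e. Proof. exact: (Pcl_partition E).1. Qed.

Lemma arr_eq e h : Lcl e = Lcl h -> arr e = arr h.
Proof. by move=> eh; apply: val_inj. Qed.

Lemma vtx_eq e h : Pcl e = Pcl h -> vtx e = vtx h.
Proof. by move=> eh; apply: val_inj. Qed.

Lemma arr_repK a : arr (arr_rep a) = a.
Proof. by apply: val_inj; rewrite /= /arr_rep; case: cid2. Qed.

Lemma vtx_surj x : exists e, vtx e = x.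
Proof. by have [e _ ex] := set_mem (valP x); exists e; apply: val_inj. Qed.

Lemma deg_act n e : deg (act n e) = deg e.
Proof. by apply/esym/f3; exists n. Qed.

Lemma size_orbit_seq n e : size (orbit_seq n e) = n.
Proof. by rewrite size_map size_rev size_iota. Qed.

Lemma path_class_comp (x y z : C) (q : @qpath Q y z) (p : @qpath Q x y) :
  kcomp (cls q) (cls p) = cls (pcat q p).
Proof. by rewrite /= quot_compE /= path_compU. Qed.

Lemma path_class_eq0 x y (p : qpath x y) :
  fbc_relations (path_mor k p) -> cls p = 0.
Proof.
move=> Rp; rewrite /path_class -[RHS](@raddf0 _ _ (qpi _)).
by apply/quot_cls_eq; rewrite subr0; apply: gen_ideal_incl.
Qed.

(** (fR2) leaves only the paths running along a single orbit, and (fR3) bounds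
    their length. *)
Lemma path_orbit x y (p : @qpath Q x y) : cls p <> 0 ->
  exists e n, [/\ (n <= deg e)%N, val p = orbit_seq n e, x = vtx e
                & y = vtx (act n%:Z e)].
Proof.
move=> p0; have [p_nil|p_cons] := eqVneq (val p) [::].
  have [e ex] := vtx_surj x; exists e, 0%N; rewrite p_nil act0 ex; split=> //.
  by have := valP p; rewrite p_nil => /= /eqP <-.
suff [e pe] : exists e, val p = orbit_seq (size (val p)) e.
  exists e, (size (val p)).
  have we := orbit_seq_walk (size (val p)) e; rewrite -pe in we.
  have [xe ye] := walk_ends p_cons (valP p) we.
  split=> //; rewrite leqNgt; apply/negP => lt_p; apply/p0/path_class_eq0.
  by right; exists (size (val p)), e, p.
have [s ps] : {s | val p = rev s} by exists (rev (val p)); rewrite revK.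
have [a0 _] : exists a0, a0 \in s.
  case: s ps => [ps|a0 s _]; first by rewrite ps in p_cons.
  by exists a0; rewrite mem_head.
(* (fR2) says nothing about a single arrow. *)
have [n_le1|n_gt1] := leqP (size s) 1.
  case: s ps n_le1 => [ps|a [|//] /= -> _]; first by rewrite ps in p_cons.
  by exists (arr_rep a); rewrite /orbit_seq /= act0 arr_repK.
pose c i := arr_rep (nth a0 s i.-1).
have sc : s = [seq arr (c i) | i <- iota 1 (size s)].
  apply: (@eq_from_nth _ a0) => [|i lti]; first by rewrite size_map size_iota.
  by rewrite (nth_map 0%N) ?size_iota // nth_iota // arr_repK.
have pc : val p = [seq arr (c i) | i <- rev (iota 1 (size s))].
  by rewrite map_rev -sc.
have [z cz] : exists z, (\bigcap_(i in [set i | (1 <= i <= size s)%N])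
    (act (size s - i)%N%:Z @` Lcl (c i))) z.
  apply/set0P/eqP => c0; apply/p0/path_class_eq0; left; right.
  by exists (size s), c, p.
(* z is the last point of the orbit piece, hence n - 1 steps after e. *)
exists (act (- (size s).-1%:Z) z); rewrite pc size_map size_rev size_iota.
rewrite /orbit_seq !map_rev -[1%N]addn0 iotaDl -map_comp; congr rev.
apply/eq_in_map => i; rewrite mem_iota add0n /= => lti.
apply: arr_eq; have [|w cw <-] := cz i.+1; first by rewrite /= lti.
(* z is g^(n-i-1).w, so the point g^i.e is w itself. *)
rewrite -!actD [X in act X w](_ : _ = 0) ?act0 ?(Lcl_eq cw) //.
have -> : (size s).-1 = (i + (size s - i.+1))%N.
  by rewrite -{1}(subnKC lti) addSn.
by rewrite PoszD opprD addrA subrr add0r addNr.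
Qed.

Lemma path_class_span x y (f : hom C x y) :
  spans (range (@path_class E k x y)) f.
Proof.
have [f' <-] := quot_cls_surj f.
apply: (@spans_map k (hom (path_cat k Q) x y) _ _ (range (@path_mor k Q x y))).
- exact: quot_cls_linear.
- by move=> _ [p _ <-]; apply: spans_incl; exists p.
have -> : f' = flift (@path_mor k Q x y) f'.
  move: f'; apply: malg_linear_ext => [a u v||p]; rewrite ?fliftU //.
  exact: flift_linear.
by move=> U pU; apply: submod_sum => p _; apply/submodZ/pU; exists p.
Qed.

Lemma vtx_fiber x :
  exists m (r : 'I_m -> E), forall e, vtx e = x -> exists i, r i = e.
Proof.
have [e0 <-] := vtx_surj x.
have /(@finite_seqP {classic E})[s Ps] := (f1 e0).2.
exists (size s), (fun i => nth (e0 : {classic E}) s i) => e.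
move=> /(congr1 val) /= ee0.
have se : (e : {classic E}) \in s.
  by have : [set` s] e by rewrite -Ps -ee0; apply: Pcl_refl.
rewrite -index_mem in se; exists (Ordinal se).
by rewrite nth_index // -index_mem.
Qed.

Lemma deg_bound x : exists d, forall e, vtx e = x -> (deg e <= d)%N.
Proof.
have [m [r rx]] := vtx_fiber x; exists (\max_i deg (r i))%N => e /rx[i <-].
exact: leq_bigmax.
Qed.

(** * Nilpotence of the arrow ideal *)

(** The span of the paths of length at least n; it plays the role of the n-th
    power of the arrow ideal. *)
Definition deep n (x y : C) : set (hom C x y) :=
  spans [set cls p | p in [set p : @qpath Q x y | (n <= size (val p))%N]].

Lemma deep_path n x y (p : qpath x y) : (n <= size (val p))%N -> deep n (cls p).
Proof. by move=> np; apply: spans_incl; exists p. Qed.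

Lemma deep_comp m n (x y z : C) (g : hom C y z) (f : hom C x y) :
  deep m g -> deep n f -> deep (m + n) (kcomp g f).
Proof.
move=> mg nf; apply: (spans_map (@kcomp_linl k C x y z f) _ mg).
move=> _ [q /= mq <-]; apply: (spans_map (kcomp_linr (cls q)) _ nf).
move=> _ [p /= np <-].
suff: deep (m + n) (cls (pcat q p)) by rewrite -path_class_comp.
by apply: deep_path; rewrite /= size_cat leq_add.
Qed.

Lemma deep0 (x y : C) (f : hom C x y) : deep 0 f.
Proof.
by move=> U pU; apply: path_class_span => _ [p _ <-]; apply: pU; exists p.
Qed.

Lemma deep_anti m n (x y : C) (f : hom C x y) :
  (m <= n)%N -> deep n f -> deep m f.
Proof.
move=> mn nf U mU; apply: nf => _ [p /= np <-]; apply: mU.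
by exists p => //=; apply: leq_trans np.
Qed.

Lemma deep_eq0 (x : C) :
  exists d, forall (y : C) (f : hom C x y), deep d.+1 f -> f = 0.
Proof.
have [d dx] := deg_bound x; exists d => y f df.
apply: (df (zero_submod (hom C x y))) => _ [p /= dp <-].
apply: contrapT => /path_orbit[e [n [ne pe xe _]]].
move: dp; rewrite pe size_orbit_seq ltnNge => /negP; apply.
by apply: leq_trans ne _; apply: dx.
Qed.

(** Passing from 1 - f to 1 - f^2 at least doubles the length of the paths in f,
    and long paths vanish. The counter m of the induction bounds the distance
    from the current length n to the vanishing length. *)
Lemma deep_unit (x : C) (f : hom C x x) : deep 1 f -> invertible (kid x - f).
Proof.
have [d dx] := deep_eq0 x.
have unit_deep m : forall n (g : hom C x x), (d < n + m)%N -> (0 < n)%N ->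
    deep n g -> invertible (kid x - g).
  elim: m => [|m IHm] n g.
    rewrite addn0 => dn n0 ng; have -> : g = 0 by apply/dx/(deep_anti dn).
    by exists (kid x); split; rewrite subr0 kcomp1f.
  move=> dnm n0 ng; apply: invertible_sqr; apply: (IHm (n + n)%N).
  - apply: leq_trans dnm _; rewrite addnS -addSn leq_add2r -addn1.
    by rewrite leq_add2l.
  - by rewrite addn_gt0 n0.
  - exact: deep_comp.
by apply: (unit_deep d); rewrite ?add1n.
Qed.

Local Notation J := (gen_ideal (arrow_classes E k)).

Lemma gen_arrow_is_ideal : is_ideal J. Proof. exact: gen_ideal_is_ideal. Qed.

Lemma arrow_ideal_deep (x y : C) (f : hom C x y) : J x y f -> deep 1 f.
Proof.
apply; last by move=> u v _ [e [p [pe ->]]]; apply: deep_path; rewrite pe.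
split=> [u v|u v a g h|u v w g h h1|u v w g h g1].
- exact: (submod0 (span_submod _)).
- exact: (submod_lin (s := span_submod _)).
- by rewrite -[1%N]add0n; apply: deep_comp => //; apply: deep0.
- by rewrite -[1%N]addn0; apply: deep_comp => //; apply: deep0.
Qed.

Lemma path_arrow_ideal x y (p : qpath x y) : val p != [::] -> J x y (cls p).
Proof.
case ps: (val p) => [//|a s] _.
have /andP[ay ws] : walk x (a :: s) y by rewrite -ps; exact: (valP p).
have wa : walk (src a) [:: a] y by apply/andP.
pose q : qpath (src a) y := Sub [:: a] wa.
pose r : qpath x (src a) := Sub s ws.
have -> : p = pcat q r by apply: val_inj.
rewrite -(path_class_comp q r); apply: (ideal_compr gen_arrow_is_ideal).
by apply: gen_ideal_incl; exists (arr_rep a), q; rewrite arr_repK.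
Qed.

Lemma arrow_ideal_off (x y : C) (f : hom C x y) : x <> y -> J x y f.
Proof.
move=> xy; pose U := ideal_submod gen_arrow_is_ideal x y.
apply: (path_class_span f (U := U)) => _ [p _ <-].
apply: path_arrow_ideal; apply/eqP => p0.
by apply: xy; apply/eqP; have := valP p; rewrite p0.
Qed.

Lemma arrow_ideal_scalar (x : C) (f : hom C x x) :
  exists c, J x x (f - c *: kid x).
Proof.
have idJ := gen_arrow_is_ideal.
pose S := [set f : hom C x x | exists c, J x x (f - c *: kid x)].
have S0 : S 0 by exists 0; rewrite scale0r subr0; apply: ideal0.
have SL (a : k) u v : S u -> S v -> S (a *: u + v).
  move=> [c Jc] [d Jd]; exists (a * c + d).
  rewrite scalerDl -scalerA opprD addrACA -scalerBr.
  exact: (ideal_lin idJ).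
apply: (path_class_span f (U := Submod S0 SL)) => _ [p _ <-].
have [p0|p0] := eqVneq (val p) [::].
  exists 1; rewrite scale1r (_ : p = pnil x) ?subrr; first exact: ideal0.
  exact: val_inj.
by exists 0; rewrite scale0r subr0; apply: path_arrow_ideal.
Qed.

(** * The arrow ideal is proper *)

(** The coefficient of the trivial path, zero when x and y differ. *)
Definition augmentation (x y : path_cat k Q) (f : hom (path_cat k Q) x y) :
    k^o :=
  flift (fun p : qpath x y => (val p == [::])%:R : k^o) f.

Lemma augmentation_path x y (p : qpath x y) :
  augmentation (path_mor k p) = (val p == [::])%:R.
Proof. exact: fliftU. Qed.

Lemma augmentation_lin x y : linear (@augmentation x y).
Proof. exact: flift_linear. Qed.

Lemma augmentationB x y (f g : hom (path_cat k Q) x y) :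
  augmentation (f - g) = augmentation f - augmentation g.
Proof. by rewrite -scaleN1r addrC augmentation_lin scaleN1r addrC. Qed.

Lemma augmentation0 x y : augmentation (0 : hom (path_cat k Q) x y) = 0.
Proof. by rewrite -{1}(subrr 0) augmentationB subrr. Qed.

Lemma augmentation_comp (x y z : path_cat k Q) (g : hom (path_cat k Q) y z)
    (f : hom (path_cat k Q) x y) :
  augmentation (kcomp g f) = augmentation g * augmentation f.
Proof.
have L := augmentation_lin.
move: g; apply: malg_linear_ext => [a u v|a u v|q].
- by rewrite kcomp_linl L.
- by rewrite L mulrDl scalerAl.
move: f; apply: malg_linear_ext => [a u v|a u v|p].
- by rewrite kcomp_linr L.
- by rewrite L mulrDr scalerAr.
rewrite -/(path_mor k q) -/(path_mor k p) /= path_compU.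
rewrite [LHS]augmentation_path !augmentation_path -natrM mulnb /=.
by rewrite -!size_eq0 size_cat addn_eq0.
Qed.

Lemma augmentation_ideal :
  is_ideal (fun x y : path_cat k Q => [set f | @augmentation x y f = 0]).
Proof.
split=> [x y|x y a f g f0 g0|x y z g f f0|x y z g f g0] /=.
- exact: augmentation0.
- by rewrite augmentation_lin f0 g0 scaler0 addr0.
- by rewrite augmentation_comp f0 mulr0.
- by rewrite augmentation_comp g0 mul0r.
Qed.

(** The hypothesis says that the full sequence of e is the beginning (the
    leftmost part) of that of h, which by (f6) cannot be proper. *)
Lemma deg_eq_top e h : (deg e <= deg h)%N ->
  (forall i, (1 <= i <= deg e)%N ->
     Lcl (act (deg e - i)%N%:Z e) = Lcl (act (deg h - i)%N%:Z h)) ->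
  deg e = deg h.
Proof.
move=> le_eh Leh.
pose Lseq (z : E) := [seq Lcl (act i%:Z z) | i <- rev (iota 0 (deg z))].
have sL z : size (Lseq z) = deg z by rewrite size_map size_rev size_iota.
have nL z i : (i < deg z)%N ->
    nth set0 (Lseq z) i = Lcl (act (deg z - i.+1)%N%:Z z).
  move=> lti; rewrite (nth_map 0%N) ?size_rev ?size_iota //.
  rewrite nth_rev ?size_iota //.
  by rewrite nth_iota ?add0n // ltn_subrL /= (leq_ltn_trans _ lti).
have Le : Lseq e = take (deg e) (Lseq h).
  apply: (@eq_from_nth _ set0) => [|i].
    by rewrite size_takel sL.
  rewrite sL => lti.
  by rewrite nth_take // !nL ?(leq_trans lti) //; apply: Leh.
have := f6 e h; rewrite -/(Lseq e) -/(Lseq h) {1}Le infix_take /= negbK.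
by move=> /eqP LL; rewrite -!sL LL.
Qed.

(** The point is (fR1): its two paths are trivial together, or neither is. *)
Lemma relations_augmentation (x y : path_cat k Q) f :
  fbc_relations (x := x) (y := y) f -> augmentation f = 0.
Proof.
case=> [[]|].
- move=> [e [h [j [p [q [+ _ Leh [_ [pe qh]] ->]]]]]].
  rewrite leq_min => /andP[je jh].
  rewrite augmentationB !augmentation_path -!size_eq0 pe qh !size_orbit_seq.
  suff -> : (deg e - j == 0)%N = (deg h - j == 0)%N by rewrite subrr.
  rewrite !subn_eq0; apply/idP/idP => [ej|hj].
    have ej' : deg e = j by apply/eqP; rewrite eqn_leq ej.
    have <- : deg e = deg h.
      by apply: deg_eq_top => [|i]; rewrite {1}ej' //; apply: Leh.
    by rewrite ej'.
  have hj' : deg h = j by apply/eqP; rewrite eqn_leq hj.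
  have <- : deg h = deg e.
    by apply: deg_eq_top => [|i]; rewrite {1}hj' // => /Leh.
  by rewrite hj'.
- move=> [n [c [p [n1 pc _ ->]]]].
  rewrite augmentation_path -size_eq0 pc size_map size_rev size_iota.
  by case: n n1 {pc}.
- move=> [n [e [p [dn pe ->]]]].
  rewrite augmentation_path -size_eq0 pe size_orbit_seq.
  by case: n dn {pe}.
Qed.

(** The morphisms that lift to augmentation 0 form an ideal containing the
    arrows; a lift of an identity has augmentation 1, as the relations do not change the
    augmentation. *)
Lemma arrow_ideal_id (x : C) : ~ J x x (kid x).
Proof.
move=> /(_ _ (image_is_ideal (gen_ideal_is_ideal (@fbc_relations E k))
  augmentation_ideal))[].
  move=> u v _ [e [p [pe ->]]]; exists (path_mor k p) => //=.
  by rewrite augmentation_path pe.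
move=> f' /= f0 idf.
have := (quot_cls_eq (gen_ideal_is_ideal (@fbc_relations E k)) f'
  (path_mor k (pnil x))).1 idf.
move=> /(_ _ augmentation_ideal relations_augmentation).
rewrite /= augmentationB f0 sub0r [augmentation _]augmentation_path eqxx.
by move/eqP; rewrite oppr_eq0 oner_eq0.
Qed.

(** * Finiteness of the total dimensions *)

(** Zero for a sequence that is not a path from x to y. *)
Definition seq_class x y (s : seq (arrow Q)) : hom C x y :=
  oapp (@path_class E k x y) 0 (insub s).

Lemma seq_classE x y (p : qpath x y) : seq_class x y (val p) = cls p.
Proof. by rewrite /seq_class valK. Qed.

(** A nonzero path from x is given by its starting point in the class x and its
    length, which is at most the degree of that point. *)
Lemma outgoing_dim (x : C) : finite_total_dim (fun y : C => hom C x y).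
Proof.
have [m [r rx]] := vtx_fiber x; have [d dx] := deg_bound x.
pose t (i : 'I_m * 'I_d.+1) : C := vtx (act i.2%:Z (r i.1)).
pose b (i : 'I_m * 'I_d.+1) (y : C) : hom C x y :=
  seq_class x y (orbit_seq i.2 (r i.1)).
apply: (finite_total_dim_spanning (t := t) (b := b)) => y f U bU.
apply: (path_class_span f (U := U)) => _ [p _ <-].
have [->|/eqP/path_orbit[e [n [ne pe xe ye]]]] := eqVneq (cls p) 0.
  exact: submod0.
have lt_nd : (n < d.+1)%N by rewrite ltnS (leq_trans ne) // dx.
have [i ri] := rx e (esym xe).
rewrite -seq_classE pe -ri.
by apply: bU; exists (i, Ordinal lt_nd); rewrite //= ye -ri.
Qed.

(** A nonzero path to y is given by the point of the class y that it reaches and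
    its length n; its starting point is n steps earlier in the orbit and has the
    same degree. *)
Lemma incoming_dim (y : C) : finite_total_dim (fun x : C => hom C x y).
Proof.
have [m [r ry]] := vtx_fiber y; have [d dy] := deg_bound y.
pose t (i : 'I_m * 'I_d.+1) : C := vtx (act (- i.2%:Z) (r i.1)).
pose b (i : 'I_m * 'I_d.+1) (x : C) : hom C x y :=
  seq_class x y (orbit_seq i.2 (act (- i.2%:Z) (r i.1))).
apply: (finite_total_dim_spanning (t := t) (b := b)) => x f U bU.
apply: (path_class_span f (U := U)) => _ [p _ <-].
have [->|/eqP/path_orbit[e [n [ne pe xe ye]]]] := eqVneq (cls p) 0.
  exact: submod0.
have lt_nd : (n < d.+1)%N.
  by rewrite ltnS (leq_trans ne) // -(deg_act n) dy.
have [i ri] := ry _ (esym ye).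
have er : e = act (- n%:Z) (r i) by rewrite ri actK.
rewrite -seq_classE pe er.
by apply: bU; exists (i, Ordinal lt_nd); rewrite //= xe er.
Qed.

Lemma gen_arrow_radical (x y : C) : J x y = radical C x y.
Proof.
apply: ideal_radical => [|u|u f|u v f|u f /arrow_ideal_deep].
- exact: gen_arrow_is_ideal.
- exact: arrow_ideal_id.
- exact: arrow_ideal_scalar.
- exact: arrow_ideal_off.
- exact: deep_unit.
Qed.

Lemma fbc_cat_locally_bounded : locally_bounded C.
Proof.
have idJ := gen_arrow_is_ideal; have J1 := arrow_ideal_id.
split=> [x|x y xy|x]; last first.
- by split; [apply: outgoing_dim | apply: incoming_dim].
- by move/(isomorphic_eq idJ J1 arrow_ideal_off).
apply: (local_end_ideal idJ J1 arrow_ideal_scalar) => z f /arrow_ideal_deep.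
exact: deep_unit.
Qed.

End Paths.

(** * Symmetries of a configuration and the Nakayama automorphism *)

(** The inverse is part of the data, so that the notion is symmetric in [tau]
    and [tau'] and both induce functors in the same way. *)
Record fbc_symmetry (E : fbc) (tau tau' : E -> E) : Prop := FbcSymmetry {
  sym_act : forall n e, tau (act n e) = act n (tau e);
  sym_deg : forall e, deg (tau e) = deg e;
  sym_P : forall e h, Pcl (tau e) = Pcl (tau h) <-> Pcl e = Pcl h;
  sym_L : forall e h, Lcl (tau e) = Lcl (tau h) <-> Lcl e = Lcl h;
  symK : cancel tau tau';
  symKV : cancel tau' tau
}.

Lemma fbc_symmetryV (E : fbc) (tau tau' : E -> E) :
  fbc_symmetry tau tau' -> fbc_symmetry tau' tau.
Proof.
case=> sact sdeg sP sL sK sKV; split=> // [n e|e|e h|e h].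
- by apply: (can_inj sK); rewrite sact !sKV.
- by rewrite -sdeg sKV.
- by rewrite -sP !sKV.
- by rewrite -sL !sKV.
Qed.

Lemma nakayama_symmetry (E : fbc) :
  fbc_symmetry (@nakayama E) (fun e => act (- (deg e)%:Z) e).
Proof.
split=> [n e|e|e h|e h|e|e]; rewrite /nakayama ?deg_act ?actK ?actKV //.
- by rewrite -!actD addrC.
- by symmetry; apply: f4.
- by symmetry; apply: f5.
Qed.

Section SymmetryFunctor.
Variables (E : fbc) (k : fieldType) (tau tau' : E -> E).
Hypothesis sym : fbc_symmetry tau tau'.
Local Notation Q := (fbc_quiver E).
Local Notation C := (fbc_cat E k).

Definition sym_vert (x : vert Q) : vert Q :=
  vtx (tau (projT1 (cid (vtx_surj x)))).
Definition sym_arrow (a : arrow Q) : arrow Q := arr (tau (arr_rep a)).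

Lemma sym_vertE e : sym_vert (vtx e) = vtx (tau e).
Proof.
rewrite /sym_vert; case: cid => h /= /(congr1 val) he.
by apply: vtx_eq; apply/(sym_P sym).
Qed.

Lemma sym_arrowE e : sym_arrow (arr e) = arr (tau e).
Proof. by apply: arr_eq; apply/(sym_L sym)/arr_repE. Qed.

Fact sym_src a : src (sym_arrow a) = sym_vert (src a).
Proof. by rewrite -(arr_repK a) sym_arrowE !src_arr sym_vertE. Qed.

Fact sym_tgt a : tgt (sym_arrow a) = sym_vert (tgt a).
Proof.
by rewrite -(arr_repK a) sym_arrowE !tgt_arr sym_vertE (sym_act sym).
Qed.

Definition sym_quiver_mor : quiver_mor Q Q := QuiverMor sym_src sym_tgt.

Lemma sym_orbit_seq n e :
  [seq sym_arrow a | a <- orbit_seq n e] = orbit_seq n (tau e).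
Proof.
by rewrite -map_comp; apply: eq_map => i; rewrite /= sym_arrowE (sym_act sym).
Qed.

(** For (fR2) the inverse permutation carries a common point of the transformed
    translates back to a common point of the original ones. *)
Lemma sym_relations (x y : path_cat k Q) (f : hom (path_cat k Q) x y) :
  fbc_relations f -> fbc_relations (fmap (path_functor k sym_quiver_mor) f).
Proof.
case=> [[]|].
- move=> [e [h [j [p [q [jeh eh Leh [xe [pe qh]] ->]]]]]].
  left; left; exists (tau e), (tau h), j.
  exists (pmap_path sym_quiver_mor p), (pmap_path sym_quiver_mor q).
  rewrite !(sym_deg sym); split=> //.
  + exact/(sym_P sym).
  + by move=> i /Leh; rewrite -!(sym_act sym) => /(sym_L sym).
  + by rewrite /= pe qh !sym_orbit_seq xe sym_vertE.
  + by rewrite fmapB /= !path_fmapE.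
- move=> [n [c [p [n1 pc c0 ->]]]].
  left; right; exists n, (tau \o c), (pmap_path sym_quiver_mor p); split=> //.
  + by rewrite /= pc -map_comp; apply: eq_map => i; rewrite /= sym_arrowE.
  + apply/eqP; apply: contraT => /set0P[z cz].
    suff : set0 (tau' z) by [].
    rewrite -c0 => i /cz[w /= cw <-].
    exists (tau' w); last by rewrite (sym_act (fbc_symmetryV sym)).
    suff -> : Lcl (c i) = Lcl (tau' w) by exact: Lcl_refl.
    by apply/(sym_L sym); rewrite (symKV sym) (Lcl_eq cw).
  + by rewrite /= path_fmapE.
- move=> [n [e [p [dn pe ->]]]].
  right; exists n, (tau e), (pmap_path sym_quiver_mor p).
  by rewrite (sym_deg sym) /= pe sym_orbit_seq path_fmapE.
Qed.

Lemma sym_ideal (x y : path_cat k Q) (f : hom (path_cat k Q) x y) :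
  gen_ideal (@fbc_relations E k) x y f ->
  gen_ideal (@fbc_relations E k) _ _ (fmap (path_functor k sym_quiver_mor) f).
Proof.
have idI := gen_ideal_is_ideal (@fbc_relations E k).
move/(_ _ (preimage_is_ideal (path_functor k sym_quiver_mor) idI)); apply.
by move=> u v g Rg /=; apply: gen_ideal_incl; apply: sym_relations.
Qed.

Definition sym_functor : kfunctor C C :=
  quot_functor (gen_ideal_is_ideal _) (gen_ideal_is_ideal _) sym_ideal.

Lemma sym_functor_obj e : sym_functor (vtx e) = vtx (tau e).
Proof. exact: sym_vertE. Qed.

Lemma sym_functor_path (x y : C) (p : @qpath Q x y) :
  fmap sym_functor (path_class p) = path_class (pmap_path sym_quiver_mor p).
Proof.
rewrite [LHS]quot_fmapE; last exact: sym_ideal.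
by congr quot_cls; apply: path_fmapE. Qed.

End SymmetryFunctor.

(** Comparing paths through their underlying sequences of arrows states
    agreement with the identity functor without transport along F x = x. *)
Lemma functor_eq_id (E : fbc) (k : fieldType)
    (F : kfunctor (fbc_cat E k) (fbc_cat E k)) :
  (forall x, F x = x) ->
  (forall (x y : fbc_cat E k) (p : @qpath (fbc_quiver E) x y),
     exists2 q : @qpath (fbc_quiver E) (F x) (F y), val q = val p &
       fmap F (path_class p) = path_class q) ->
  F = idfunctor (fbc_cat E k).
Proof.
case: F => F0 F1 lF idF compF /= F0id.
have F0E : F0 = id by apply/funext.
subst F0 => F1p.
have F1E : F1 = fun x y f => f.
  apply: functional_extensionality_dep => x.
  apply: functional_extensionality_dep => y; apply/funext => f.
  have fix0 : F1 x y 0 = 0.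
    by rewrite -{1}[0]addr0 -{1}[0](scaler0 _ (-1)) lF scaleN1r addNr.
  have fixL (a : k) u v : F1 x y u = u -> F1 x y v = v ->
      F1 x y (a *: u + v) = a *: u + v.
    by rewrite lF => -> ->.
  pose U := @Submod _ _ [set u | F1 x y u = u] fix0 fixL.
  apply: (path_class_span f (U := U)).
  by move=> _ [p _ <-] /=; have [q /val_inj -> ->] := F1p x y p.
subst F1; congr KFunctor; exact: Prop_irrelevance.
Qed.

Lemma sym_functorK (E : fbc) (k : fieldType) (tau tau' : E -> E)
    (s : fbc_symmetry tau tau') (s' : fbc_symmetry tau' tau) :
  compfunctor (sym_functor k s') (sym_functor k s) = idfunctor (fbc_cat E k).
Proof.
apply: functor_eq_id => [x|x y p].
  have [e <-] := vtx_surj x.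
  by rewrite /= (sym_vertE s) (sym_vertE s') (symK s).
exists (pmap_path (sym_quiver_mor s') (pmap_path (sym_quiver_mor s) p)).
  rewrite /= -map_comp -[RHS]map_id; apply: eq_map => a /=.
  by rewrite -(arr_repK a) (sym_arrowE s) (sym_arrowE s') (symK s).
by rewrite [LHS]/= -!sym_functor_path.
Qed.

Theorem theorem4p7 (k : fieldType) (E : fbc) :
  [/\ forall x y : fbc_cat E k,
        gen_ideal (arrow_classes E k) x y = radical (fbc_cat E k) x y,
      locally_bounded (fbc_cat E k)
    & exists F : kfunctor (fbc_cat E k) (fbc_cat E k),
      [/\ is_automorphism F,
          forall e : E, F (vtx e) = vtx (nakayama e)
        & forall (e : E) (x y : fbc_cat E k) (p : @qpath (fbc_quiver E) x y),
            val p = [:: arr e] ->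
            exists q : @qpath (fbc_quiver E) (F x) (F y),
              val q = [:: arr (nakayama e)] /\
              fmap F (path_class p) = path_class q]].
Proof.
split; [exact: gen_arrow_radical | exact: fbc_cat_locally_bounded |].
have s := nakayama_symmetry E; have s' := fbc_symmetryV s.
exists (sym_functor k s); split=> [|e|e x y p pe].
- by exists (sym_functor k s'); split; apply: sym_functorK.
- exact: sym_functor_obj.
exists (pmap_path (sym_quiver_mor s) p); split; last exact: sym_functor_path.
by rewrite /= pe /= (sym_arrowE s).
Qed.
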